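(* Let $X$ be a normed real vector space and let $\theta=(k_r)$ be a lacunary sequence. Then $X$ is complete if and only if $S_{N_\theta}(\sum_i x_i)$ is a complete space (with the supremum norm) for every weakly unconditionally Cauchy series (wuC) $\sum_i x_i$ in $X$.
   Context: A lacunary sequence is a (strictly) increasing sequence $\theta=(k_r)_{r\ge 0}$ of natural numbers with $k_0=0$ and $h_r=k_r-k_{r-1}\to+\infty$ as $r\to\infty$. For $r\ge 1$ put $I_r=(k_{r-1},k_r]$ (the set of integers $k$ with $k_{r-1}<k\le k_r$). A sequence $(s_k)$ in the normed space $X$ is $N_\theta$-summable (lacunary strongly convergent) to $L\in X$ if $\lim_{r\to\infty}\frac{1}{h_r}\sum_{k\in I_r}\|s_k-L\|=0$. A series $\sum_i z_i$ in $X$ is $N_\theta$-summable if its sequence of partial sums $s_k=\sum_{i=1}^k z_i$ is $N_\theta$-summable to some $L\in X$. $\ell_\infty$ is the space of bounded real sequences. For a series $\sum_i x_i$ in $X$, $$S_{N_\theta}\Big(\sum_i x_i\Big)=\Big\{(a_i)_i\in\ell_\infty:\ \sum_i a_i x_i \text{ is } N_\theta\text{-summable}\Big\},$$ endowed with the supremum norm. A series $\sum_i x_i$ in $X$ is weakly unconditionally Cauchy (wuC) if for every permutation $\pi$ of $\mathbb{N}$ the sequence $(\sum_{i=1}^n x_{\pi(i)})_n$ is weakly Cauchy; equivalently, $\sum_i|f(x_i)|<\infty$ for every $f\in X^*$. *)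

(* Defs.v *)
From HB Require Import structures.
From mathcomp Require Import all_boot all_order all_algebra.
From mathcomp Require Import all_classical all_reals all_analysis.

Set Implicit Arguments.
Unset Strict Implicit.
Unset Printing Implicit Defensive.

Import Order.TTheory GRing.Theory Num.Theory.
Import numFieldNormedType.Exports.

Local Open Scope classical_set_scope.
Local Open Scope ring_scope.

(* Indexing: a series is given by its terms [x 0, x 1, ...], so [series x k]
   is the sum of the first [k] terms, i.e. the k-th partial sum
   [x_1 + ... + x_k] of the usual notation. *)

Section linfty.
Context {R : realType}.

Definition linfty_pred : {pred (nat -> R)} :=
  [pred a | `[< bounded_fun (a : nat -> R) >]].

Lemma linftyP (a : nat -> R) :
  reflect (exists M, forall i, `|a i| <= M) (a \in linfty_pred).
Proof.
have PF : ProperFilter (globally [set: nat]).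
  exact: (@globally_properfilter _ _ 0%N).
apply: (equivP (asboolP _)); split=> [|[M aM]].
  by rewrite /= ex_bound => -[M aM]; exists M => i; exact: aM.
by rewrite /= ex_bound; exists M => i _; exact: aM.
Qed.

Lemma linfty_submod_closed : submod_closed linfty_pred.
Proof.
split=> [|c a b /linftyP[M aM] /linftyP[N bN]].
  by apply/linftyP; exists 0 => i; rewrite normr0.
apply/linftyP; exists (`|c| * M + N) => i.
rewrite (le_trans (ler_normD _ _))// lerD// normrM.
by rewrite ler_wpM2l.
Qed.

HB.instance Definition _ :=
  GRing.isSubmodClosed.Build R (nat -> R) linfty_pred linfty_submod_closed.

End linfty.

Section linfty_type.
Variable R : realType.

Record linfty := Linfty {
  linfty_fun :> nat -> R ;
  linfty_bounded : linfty_fun \in linfty_pred }.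

HB.instance Definition _ := [isSub for linfty_fun].
HB.instance Definition _ := [Choice of linfty by <:].
HB.instance Definition _ := [SubChoice_isSubLmodule of linfty by <:].

Definition supnorm (a : linfty) : R := sup (range (fun i => `|a i|)).

Let has_sup_norm (a : linfty) : has_sup (range (fun i => `|a i|)).
Proof.
split; first by exists `|a 0|, 0%N.
by have /linftyP[M aM] := linfty_bounded a; exists M => _ [i _ <-].
Qed.

Lemma le_supnorm (a : linfty) i : `|a i| <= supnorm a.
Proof. by apply: ub_le_sup; [case: (has_sup_norm a)|exists i]. Qed.

Lemma supnorm_le (a : linfty) M : (forall i, `|a i| <= M) -> supnorm a <= M.
Proof. by move=> aM; apply: ge_sup => [|_ [i _ <-]//]; exists `|a 0|, 0%N. Qed.

Let ler_supnormD (a b : linfty) : supnorm (a + b) <= supnorm a + supnorm b.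
Proof.
apply: supnorm_le => i.
by rewrite (le_trans (ler_normD _ _))// lerD// le_supnorm.
Qed.

Let supnormZ_le (c : R) (a : linfty) : supnorm (c *: a) <= `|c| * supnorm a.
Proof.
by apply: supnorm_le => i; rewrite normrM ler_wpM2l// le_supnorm.
Qed.

Let supnormZ (c : R) (a : linfty) : supnorm (c *: a) = `|c| * supnorm a.
Proof.
apply/eqP; rewrite eq_le supnormZ_le /=.
have [->|c0] := eqVneq c 0.
  by rewrite normr0 mul0r (le_trans _ (le_supnorm _ 0%N)).
rewrite -ler_pdivlMl ?normr_gt0// -normfV.
by rewrite -[in leLHS](scalerK c0 a) supnormZ_le.
Qed.

Let supnorm_eq0 (a : linfty) : supnorm a = 0 -> a = 0.
Proof.
move=> a0; apply/val_inj/funext => i; apply/eqP.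
by rewrite -normr_le0 -a0; exact: le_supnorm.
Qed.

HB.instance Definition _ :=
  Lmodule_isNormed.Build R linfty ler_supnormD supnormZ supnorm_eq0.

End linfty_type.

Lemma linfty_normE (R : realType) (a : linfty R) :
  `|a| = sup (range (fun i => `|a i|)).
Proof. by []. Qed.

(* The property required by the library structure [completeType]. *)
Definition complete_space (T : uniformType) : Prop :=
  forall F : set_system T, ProperFilter F -> cauchy F -> exists l : T, F --> l.

(* [h_r = k_r - k_(r-1)] for [r >= 1]; the value [0] at [r = 0] is junk. *)
Definition lac_step (theta : nat -> nat) (r : nat) : nat :=
  (theta r - theta r.-1)%N.

Definition lacunary (theta : nat -> nat) : Prop :=
  [/\ theta 0%N = 0%N,
      {homo theta : m n / (m < n)%N} &
      lac_step theta @ \oo --> \oo].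

Section lacunary_summability.
Context {R : realType} {X : normedModType R}.
Implicit Types (theta : nat -> nat) (s x z : nat -> X) (L : X).

Definition Ntheta_cvg_to theta s L : Prop :=
  (fun r => (lac_step theta r)%:R^-1 *
     \sum_((theta r.-1).+1 <= k < (theta r).+1) `|s k - L|) @ \oo --> (0 : R).

Definition Ntheta_summable theta z : Prop :=
  exists L, Ntheta_cvg_to theta (series z) L.

(* Its uniformity as a space, [set_type (S_Ntheta theta x)], is the one induced
   by the sup norm of [linfty R]. *)
Definition S_Ntheta theta x : set (linfty R) :=
  [set a | Ntheta_summable theta (fun i => a i *: x i)].

Definition weakly_cauchy s : Prop :=
  forall f : {scalar X}, continuous f -> cauchy ((f \o s) @ \oo).

Definition wuC x : Prop :=
  forall pi : nat -> nat, bijective pi -> weakly_cauchy (series (x \o pi)).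

End lacunary_summability.

(* Main.v *)
(* Let [x] be wuC.  Every rearrangement of [\sum_i f (x i)] converges for [f] in
   the dual, so [\sum_i `|f (x i)|] is finite, and the uniform boundedness
   principle gives [C] with [`|\sum_(i < n) b i *: x i| <= C * `|b|] for all
   bounded [b] and all [n].  Hence if [a n --> b] uniformly with
   [\sum_i a n i *: x i] summable to [L n], then [L] is Cauchy, and when [X] is
   complete its limit is the N_theta-sum of [\sum_i b i *: x i]: the multiplier
   space is closed in l_infty.
   Conversely, if [u] is a fast Cauchy sequence in [X], the series with terms
   [x n := (n + 1) *: (u n.+1 - u n)] is absolutely convergent, hence wuC.  The
   truncations of [1 / (n + 1)] are multipliers converging uniformly to
   [1 / (n + 1)], so by completeness [u n - u 0], the partial sums of
   [\sum_n 1 / (n + 1) *: x n], is N_theta-convergent; being Cauchy, it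
   converges. *)
From HB Require Import structures.
Require Import Defs.
From mathcomp Require Import all_boot all_order all_algebra.
From mathcomp Require Import all_classical all_reals all_analysis.
From mathcomp Require Import lra.

Set Implicit Arguments.
Unset Strict Implicit.
Unset Printing Implicit Defensive.

Import Order.TTheory GRing.Theory Num.Theory.
Import numFieldNormedType.Exports.

Local Open Scope classical_set_scope.
Local Open Scope ring_scope.

(** * Permutations of the naturals assembled from finite blocks *)

Lemma exists_block (N : nat -> nat) : N 0%N = 0%N ->
  (forall j, N j < N j.+1)%N -> forall n, exists j, (N j <= n < N j.+1)%N.
Proof.
move=> N0 Nlt; elim=> [|n [j /andP[jn nj]]].
  by exists 0%N; rewrite N0 leqnn -[X in (X < _)%N]N0 Nlt.
have [nNj|Njn] := ltnP n.+1 (N j.+1).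
  by exists j; rewrite nNj (leq_trans jn).
exists j.+1; rewrite Njn /=.
by rewrite (leq_ltn_trans _ (Nlt j.+1)).
Qed.

Lemma block_uniq (N : nat -> nat) : (forall j, N j < N j.+1)%N ->
  forall n i j, (N i <= n < N i.+1)%N -> (N j <= n < N j.+1)%N -> i = j.
Proof.
move=> Nlt n.
have le_ i j : (N i <= n < N i.+1)%N -> (N j <= n < N j.+1)%N -> (i <= j)%N.
  move=> /andP[iN _] /andP[_ nj]; rewrite leqNgt; apply/negP => ji.
  have : (N j.+1 <= N i)%N.
    by apply: (homo_leq leqnn leq_trans _ ji) => k; exact: ltnW.
  by rewrite leqNgt (leq_ltn_trans iN nj).
by move=> i j hi hj; apply/eqP; rewrite eqn_leq (le_ i j hi hj) (le_ j i hj hi).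
Qed.

(** A position is coded by its block and its offset there. Reading the offset in [L j] permutes
    block [j], and [index] inverts this. *)
Lemma block_permutation (N : nat -> nat) (L : nat -> seq nat) : N 0%N = 0%N ->
    (forall j, N j < N j.+1)%N ->
    (forall j, perm_eq (L j) (index_iota (N j) (N j.+1))) ->
  exists2 pi : nat -> nat, bijective pi &
    forall j i, (i < size (L j))%N -> pi (N j + i)%N = nth 0%N (L j) i.
Proof.
move=> N0 Nlt LN.
have [b bP] := choice (exists_block N0 Nlt).
have sizeL j : size (L j) = (N j.+1 - N j)%N.
  by rewrite (perm_size (LN j)) size_iota.
have memL j n : (n \in L j) = (N j <= n < N j.+1)%N.
  by rewrite (perm_mem (LN j)) mem_index_iota.
have uniqL j : uniq (L j) by rewrite (perm_uniq (LN j)) iota_uniq.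
have bE j n : (N j <= n < N j.+1)%N -> b n = j by exact: block_uniq.
have offs n : (n - N (b n) < size (L (b n)))%N.
  have /andP[Nn nN] := bP n.
  by rewrite sizeL ltn_sub2r// (leq_ltn_trans Nn).
pose p n := nth 0%N (L (b n)) (n - N (b n)).
pose q m := (N (b m) + index m (L (b m)))%N.
have bp n : b (p n) = b n by apply: bE; rewrite -memL mem_nth.
have bq m : b (q m) = b m.
  apply: bE; rewrite leq_addr /= -ltn_subRL -sizeL index_mem memL.
  exact: bP.
exists p => [|j i iL].
  exists q => n.
    rewrite /q bp index_uniq ?offs//.
    by rewrite subnKC//; have /andP[] := bP n.
  by rewrite /p bq /q addKn nth_index// memL.
have bj : b (N j + i)%N = j.
  by apply: bE; rewrite leq_addr -ltn_subRL -sizeL.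
by rewrite /p bj addKn.
Qed.

(** * Absolute summability from rearrangements *)

Section abs_sum.
Variable R : realType.
Implicit Types c : nat -> R.

(** The nonnegative terms or the negative ones account for at least half of the absolute sum. *)
Lemma large_partial_sum c (s : seq nat) (d : R) :
  2 * d <= \sum_(i <- s) `|c i| ->
  exists p : pred nat, d <= `|\sum_(i <- s | p i) c i|.
Proof.
move=> ds.
have sE : \sum_(i <- s) `|c i| =
    \sum_(i <- s | 0 <= c i) c i - \sum_(i <- s | ~~ (0 <= c i)) c i.
  rewrite (bigID (fun i => 0 <= c i)) /= -sumrN; congr (_ + _).
    by apply: eq_bigr => i ci; rewrite ger0_norm.
  by apply: eq_bigr => i; rewrite -ltNge => ci; rewrite ltr0_norm.
have [dp|pd] := leP d (\sum_(i <- s | 0 <= c i) c i).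
  by exists (fun i => 0 <= c i); rewrite (le_trans dp)// ler_norm.
exists (fun i => ~~ (0 <= c i)).
rewrite -normrN (le_trans _ (ler_norm _))//.
by move: ds; rewrite sE; lra.
Qed.

(* Otherwise one could put, in infinitely many disjoint blocks of indices, a
   subset over which [c] has a sum of modulus [>= 1] first. *)
Lemma rearrangements_cauchy_abs_bounded c :
    (forall pi : nat -> nat, bijective pi -> cauchy (series (c \o pi) @ \oo)) ->
  exists M, forall n, \sum_(i < n) `|c i| <= M.
Proof.
move=> cauchy_c; apply: contrapT => unbounded.
have blockP n : exists Lk : seq nat * nat, exists m, [/\ (n < m)%N,
    perm_eq Lk.1 (index_iota n m), (Lk.2 <= size Lk.1)%N &
    1 <= `|\sum_(i <- take Lk.2 Lk.1) c i|].
  (* The excess [2] is what [large_partial_sum] needs for a subset of the block with sum of modulus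
     at least [1]. *)
  have [m mP] : exists m, \sum_(i < n) `|c i| + 2 < \sum_(i < m) `|c i|.
    apply: contrapT => noM; apply: unbounded.
    exists (\sum_(i < n) `|c i| + 2) => m; rewrite leNgt; apply/negP => ?.
    by apply: noM; exists m.
  have nm : (n < m)%N.
    rewrite ltnNge; apply/negP => mn; move: mP; apply/negP; rewrite -leNgt.
    rewrite -!(big_mkord xpredT (fun i => `|c i|)).
    rewrite (@big_cat_nat _ _ _ m 0%N n)//=.
    rewrite -addrA lerDl addr_ge0// sumr_ge0// => i _.
  have [|p p1] := @large_partial_sum c (index_iota n m) 1.
    rewrite mulr1; move: mP.
    rewrite -!(big_mkord xpredT (fun i => `|c i|)).
    rewrite (@big_cat_nat _ _ _ n 0%N m)//= ?(ltnW nm)//.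
    by rewrite ltrD2l => /ltW.
  pose l := index_iota n m; pose lp := [seq i <- l | p i].
  exists (lp ++ [seq i <- l | predC p i], size lp), m.
  split=> //=; first by rewrite perm_filterC.
    by rewrite size_cat leq_addr.
  by rewrite take_size_cat// big_filter.
have [Lk /choice[e LkP]] := choice blockP.
pose N j := iter j e 0%N.
have Nlt j : (N j < N j.+1)%N by case: (LkP (N j)).
have [j|pi pi_bij piE] :=
  @block_permutation N (fun j => (Lk (N j)).1) erefl Nlt.
  by case: (LkP (N j)).
have leN j : (j <= N j)%N.
  by elim: j => // j ih; rewrite (leq_ltn_trans ih).
have /cauchy_seriesP/(_ _ ltr01) := cauchy_c _ pi_bij.
case=> -[A B] /= [[a _ aA] [b _ bB]] AB.
(* As [j <= N j], block [j] lies beyond both Cauchy thresholds, and its leading segment, with sum of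
   modulus at least [1], gives the contradiction. *)
pose j := maxn a b.
have [_ _ ks s1] := LkP (N j).
move: s1; apply/negP; rewrite -ltNge.
have {}AB : `|\sum_(N j <= k < N j + (Lk (N j)).2) c (pi k)| < 1.
  apply: (AB (N j, N j + (Lk (N j)).2)%N); split; [apply: aA|apply: bB] => /=.
    by rewrite (leq_trans _ (leN j))// leq_maxl.
  by rewrite (leq_trans _ (leq_addr _ _))// (leq_trans _ (leN j))// leq_maxr.
rewrite (_ : \sum_(i <- _) c i =
  \sum_(N j <= k < N j + (Lk (N j)).2) c (pi k))//.
rewrite (big_nth 0%N) size_take_min (minn_idPl ks).
rewrite -[X in _ = \sum_(X <= _ < _) _]add0n big_addn addKn.
rewrite !big_mkord; apply: eq_bigr => i _.
by rewrite [(i + _)%N]addnC piE ?nth_take// (leq_trans _ ks).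
Qed.

End abs_sum.

(** * Hahn-Banach: norming functionals *)

Section hahn_banach.
Context {R : realType} {X : normedModType R}.
Implicit Types (G : set (X * R)) (x y : X) (r s t : R).

(* Partial functionals are represented by their graphs, so that the empty
   graph is allowed; domination by the norm makes them single-valued. *)
Definition dominated_graph G : Prop :=
  (forall x r y s t, G (x, r) -> G (y, s) -> G (t *: x + y, t * r + s)) /\
  (forall x r, G (x, r) -> r <= `|x|).

Lemma dominated_graph0 G x r : dominated_graph G -> G (x, r) -> G (0, 0).
Proof.
move=> [lin _] Gxr; have := lin _ _ _ _ (-1) Gxr Gxr.
by rewrite scaleN1r addNr mulN1r addNr.
Qed.

Lemma dominated_graphZ G x r t :
  dominated_graph G -> G (x, r) -> G (t *: x, t * r).
Proof.
move=> domG Gxr; have := domG.1 _ _ _ _ t Gxr (dominated_graph0 domG Gxr).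
by rewrite !addr0.
Qed.

Lemma dominated_graph_uniq G x r s :
  dominated_graph G -> G (x, r) -> G (x, s) -> r = s.
Proof.
move=> domG.
suff le_ r' s' : G (x, r') -> G (x, s') -> s' <= r'.
  by move=> xr xs; apply/eqP; rewrite eq_le !le_.
move=> xr xs; have := domG.1 _ _ _ _ (-1) xr xs => /domG.2.
by rewrite scaleN1r addNr normr0 mulN1r addrC subr_le0.
Qed.

Lemma dominated_graph_line x :
  dominated_graph [set p | exists t, p = (t *: x, t * `|x|)].
Proof.
split=> [y r z s t [a [-> ->]] [b [-> ->]]|y r [t [-> ->]]].
  by exists (t * a + b); rewrite scalerA -scalerDl mulrA -mulrDl.
by rewrite normrZ ler_wpM2r// ler_norm.
Qed.

(** The value [a] at [v] must lie above every [r - |x - v|] and below every [|y + v| - s]. By the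
    triangle inequality the former never exceed the latter, so their supremum will do. *)
Lemma dominated_graph_extend G (v : X) : dominated_graph G -> G !=set0 ->
  exists a, dominated_graph [set p | exists x r t,
    G (x, r) /\ p = (x + t *: v, r + t * a)].
Proof.
move=> domG [[x0 r0] G0].
pose S := [set p.2 - `|p.1 - v| | p in G].
have bound x r y s : G (x, r) -> G (y, s) -> r - `|x - v| <= `|y + v| - s.
  move=> xr ys; rewrite lerBrDr addrAC lerBlDl.
  have := domG.1 _ _ _ _ 1 xr ys => /domG.2;
    rewrite scale1r mul1r => /le_trans; apply.
  by rewrite (_ : x + y = (x - v) + (y + v)) ?ler_normD// addrACA addNr addr0.
have S0 : S !=set0 by exists (r0 - `|x0 - v|), (x0, r0).
have supS : has_sup S.
  by split=> //; exists (`|x0 + v| - r0) => _ [[x r] xr <-]; exact: bound.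
exists (sup S); split.
  move=> _ _ _ _ t [x [r [b [xr [-> ->]]]]] [y [s [c [ys [-> ->]]]]].
  exists (t *: x + y), (t * r + s), (t * b + c); split; first exact: domG.1.
  congr (_, _); first by rewrite scalerDr scalerDl scalerA addrACA.
  by rewrite mulrDr mulrDl mulrA addrACA.
move=> _ _ [x [r [t [xr [-> ->]]]]].
have scaled u : 0 < u -> `|x + t *: v| = u * `|u^-1 *: x + (u^-1 * t) *: v|.
  move=> u0; rewrite -scalerA -scalerDr normrZ gtr0_norm ?invr_gt0//.
  by rewrite mulrA mulfV ?gt_eqF// mul1r.
(* Dividing by [|t|] makes the coefficient of [v] equal to [-1] or [1]. For [t < 0] it matters that
   [sup S] is an upper bound, for [t > 0] that it is the least one. *)
have [t0|t0|->] := ltgtP t 0;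
  last by rewrite scale0r mul0r !addr0; exact: domG.2.
  have u0 : 0 < - t by rewrite oppr_gt0.
  have tN : (- t)^-1 * t = -1 by rewrite invrN mulNr mulVf ?lt_eqF.
  rewrite (scaled _ u0) tN scaleN1r.
  have : (- t)^-1 * r - `|(- t)^-1 *: x - v| <= sup S.
    apply: ub_le_sup supS.2 _ _.
    by exists ((- t)^-1 *: x, (- t)^-1 * r) => //; exact: dominated_graphZ.
  rewrite lerBlDr -(ler_pM2l u0) mulrDr mulrA mulfV ?gt_eqF// mul1r.
  by lra.
rewrite (scaled _ t0) mulVf ?gt_eqF// scale1r.
have : sup S <= `|t^-1 *: x + v| - t^-1 * r.
  apply: ge_sup => // _ [[y s] ys <-]; apply: bound => //.
  exact: dominated_graphZ.
rewrite -(ler_pM2l t0) mulrBr mulrA mulfV ?gt_eqF// mul1r.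
by rewrite lerBrDr addrC.
Qed.

Lemma dominated_graph_total x : exists G, [/\ dominated_graph G,
  G (x, `|x|) & forall v, exists r, G (v, r)].
Proof.
pose G0 := [set p | exists t, p = (t *: x, t * `|x|)].
(* The empty chain has the empty graph as its union, so [G0] is required only inside nonempty
   graphs. *)
pose P G := dominated_graph G /\ (G !=set0 -> G0 `<=` G).
have [F FP Ftot|G [[domG G0G] maxG]] := @Zorn_bigcup _ P.
  split; last first.
    move=> [p [G FG Gp]] q G0q; exists G => //.
    by have [_ /(_ (ex_intro _ _ Gp))] := FP _ FG; exact.
  split=> [y r z s t [G FG yr] [H FH zs]|y r [G FG]]; last exact: (FP _ FG).1.2.
  have [GH|HG] := Ftot _ _ FG FH.
    by exists H => //; apply: (FP _ FH).1.1 => //; exact: GH.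
  by exists G => //; apply: (FP _ FG).1.1 => //; exact: HG.
have Gn0 : G !=set0.
  apply: contrapT => /nonemptyPn G_0.
  have G0x : G0 (x, `|x|) by exists 1; rewrite scale1r mul1r.
  apply: (maxG G0); first by rewrite G_0; split=> // /(_ _ G0x).
  by split=> [|_]; [exact: dominated_graph_line|exact: subset_refl].
exists G; split=> //.
  by apply: (G0G Gn0); exists 1; rewrite scale1r mul1r.
(* Were [v] without a value, [H] would extend the maximal graph properly. *)
move=> v; apply: contrapT => Gv.
have [a] := dominated_graph_extend v domG Gn0.
set H := (X in dominated_graph X) => domH.
have GH : G `<=` H.
  by move=> [y r] yr; exists y, r, 0; rewrite scale0r mul0r !addr0.
apply: (maxG H).
  split=> // HG; apply: Gv; exists a; apply: HG.
  have [[y r] yr] := Gn0; exists 0, 0, 1; split;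
    first exact: dominated_graph0 yr.
  by rewrite scale1r mul1r !add0r.
by split=> // _; exact: subset_trans (G0G Gn0) GH.
Qed.

Lemma bounded_scalar_continuous (f : {scalar X}) (M : R) :
  (forall y, `|f y| <= M * `|y|) -> continuous f.
Proof.
move=> fM; pose g : {linear X -> R^o} := f.
apply: (@bounded_linear_continuous _ X R^o g); apply/linear_boundedP.
near=> r => y; rewrite (le_trans (fM y))// ler_wpM2r//.
Unshelve. all: by end_near. Qed.

(** A total dominated graph is the graph of a linear functional; domination at [- y] gives the lower
    bound on [f y]. *)
Lemma norming_functional x : exists f : {scalar X},
  (forall y, `|f y| <= `|y|) /\ f x = `|x|.
Proof.
have [G [domG Gx /choice[f fG]]] := dominated_graph_total x.
have fE y r : G (y, r) -> f y = r.
  by move=> yr; exact: (dominated_graph_uniq domG).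
have flin : linear_for *%R f.
  by move=> t y z; apply: fE; apply: domG.1.
pose fL := GRing.isLinear.Build _ _ _ _ f flin.
pose F : {scalar X} := HB.pack f fL.
exists F; split=> [y|]; last exact: fE.
rewrite ler_norml (domG.2 _ _ (fG y)) andbT lerNl.
have := domG.2 _ _ (dominated_graphZ (-1) domG (fG y)).
by rewrite scaleN1r mulN1r normrN.
Qed.

End hahn_banach.

(** * Uniform boundedness and multipliers of a wuC series *)

Section uniform_boundedness.
Context {R : realType}.

(** The intervals [[u n - e n, u n + e n]] are nested, and the supremum of their left endpoints lies
    in all of them. *)
Lemma telescoping_limit (u e : nat -> R) :
    (forall n, `|u n.+1 - u n| <= e n - e n.+1) -> (forall n, 0 <= e n) ->
  exists l, forall n, `|l - u n| <= e n.
Proof.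
move=> ue e0.
have uD n k : `|u (n + k)%N - u n| <= e n - e (n + k)%N.
  elim: k => [|k ih]; first by rewrite addn0 !subrr normr0.
  rewrite addnS.
  have := ler_normD (u (n + k).+1 - u (n + k)%N) (u (n + k)%N - u n).
  rewrite addrA subrK => /le_trans; apply.
  by have := ue (n + k)%N; lra.
pose v n := u n - e n.
have vu n m : v n <= u m + e m.
  have [nm|/ltnW mn] := leqP n m.
    have := uD n (m - n)%N; rewrite subnKC// ler_norml /v => /andP[+ _].
    by have := e0 m; lra.
  have := uD m (n - m)%N; rewrite subnKC// ler_norml /v => /andP[_].
  by have := e0 n; lra.
have supv : has_sup (range v).
  by split; [exists (v 0%N), 0%N|exists (u 0%N + e 0%N) => _ [n _ <-]].
exists (sup (range v)) => n; rewrite ler_norml; apply/andP; split.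
  by rewrite lerBrDl; apply: ub_le_sup supv.2 _ _; exists n.
by rewrite lerBlDl; apply: ge_sup supv.1 _ => _ [m _ <-].
Qed.

Lemma le_pow3_eq0 (a C : R) : (forall n, `|a| <= C * 3^-1 ^+ n) -> a = 0.
Proof.
move=> aC; apply/eqP; rewrite -normr_eq0; apply: contrapT => /negP a0.
have {}a0 : 0 < `|a| by rewrite lt_neqAle eq_sym a0 normr_ge0.
have C0 : 0 <= C by have := aC 0%N; rewrite expr0 mulr1; apply: le_trans.
have [n nC] : exists n, C / `|a| < n%:R.
  by exists (Num.bound (C / `|a|)); exact: archi_boundP (divr_ge0 _ _).
have := aC n; apply/negP; rewrite -ltNge exprVn ltr_pdivrMr ?exprn_gt0//.
move: nC; rewrite ltr_pdivrMr// => /lt_le_trans; apply.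
rewrite mulrC ler_wpM2l// -natrX ler_nat; exact/ltnW/ltn_expl.
Qed.

(** If [|a + b| < b] then [a < 0], and subtracting [b] moves [a] further from zero. *)
Lemma sign_choice (a b : R) : 0 <= b ->
  b <= `|a + (if b <= `|a + b| then b else - b)|.
Proof.
move=> b0; case: ifPn => //; rewrite -ltNge ltr_norml => /andP[_ ab].
by rewrite ler_normr; apply/orP; right; lra.
Qed.

(* A gliding hump argument: if [y n] in [B] had norm [> n * 3 ^ n], then a
   signed sum [\sum_n +- 3^-n g_n] of functionals norming the [y n] would be
   unbounded on [B].  The signs prevent cancellation between the [n]-th term
   and its predecessors, and the later terms are too small to matter. *)
Lemma weakly_bounded (X : normedModType R) (B : set X) :
    (forall f : {scalar X}, continuous f ->
      exists M, forall y, B y -> `|f y| <= M) ->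
  exists M, forall y, B y -> `|y| <= M.
Proof.
move=> wB; apply: contrapT => unbounded.
have /choice[y yP] n : exists y, B y /\ n%:R * 3 ^+ n < `|y|.
  apply: contrapT => noy; apply: unbounded; exists (n%:R * 3 ^+ n) => z Bz.
  by rewrite leNgt; apply/negP => ?; apply: noy; exists z.
have /choice[g gP] n := norming_functional (y n).
pose q n : R := 3^-1 ^+ n.
have q0 n : 0 < q n by rewrite exprn_gt0// invr_gt0.
have qS n : q n.+1 = q n / 3 by rewrite /q exprSr.
(* Here [h] is the sum of the earlier terms; the sign is the one that [sign_choice] selects at
   [y n]. *)
pose s n (h : X -> R) : R :=
  if q n * `|y n| <= `|h (y n) + q n * `|y n| | then q n else - q n.
have normq n h : `|s n h| = q n.
  by rewrite /s; case: ifP => _; rewrite ?normrN gtr0_norm.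
pose F := fix F n : X -> R :=
  if n is n'.+1 then fun z => F n' z + s n' (F n') * g n' z else fun=> 0.
have FL n t z w : F n (t *: z + w) = t * F n z + F n w.
  elim: n => [|n ih] /=; first by rewrite mulr0 addr0.
  by rewrite ih linearP /= ; lra.
(* The geometric tail: the sum of [3^-j * |z|] over [j >= n]. *)
pose e n (z : X) : R := 3 / 2 * `|z| * q n.
have /choice[f fP] z : exists l, forall n, `|l - F n z| <= e n z.
  apply: telescoping_limit => n; last first.
    by rewrite /e !mulr_ge0// ltW.
  rewrite /= addrAC subrr add0r normrM normq /e qS.
  have := (gP n).1 z; rewrite -(ler_pM2l (q0 n)); lra.
have flin : linear_for *%R f.
  move=> t z w; apply/eqP; rewrite -subr_eq0; apply/eqP.
  apply: (@le_pow3_eq0 _ (3 / 2 * (`|t *: z + w| + `|t| * `|z| + `|w|))) => n.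
  have -> : f (t *: z + w) - (t * f z + f w) =
      (f (t *: z + w) - F n (t *: z + w)) - t * (f z - F n z) - (f w - F n w).
    by rewrite FL; lra.
  rewrite (le_trans (ler_normB _ _))//
    (le_trans (lerD (ler_normB _ _) (fP w n)))//.
  have : `|t * (f z - F n z)| <= `|t| * e n z by rewrite normrM ler_wpM2l.
  by have := fP (t *: z + w) n; rewrite /e -/(q n); lra.
pose fL := GRing.isLinear.Build _ _ _ _ f flin.
pose f' : {scalar X} := HB.pack f fL.
have [|M fM] := wB f'.
  apply: (@bounded_scalar_continuous _ _ _ (3 / 2)) => z.
  by have := fP z 0%N; rewrite /= subr0 /e /q expr0 mulr1.
(* The tail from [n.+1] on is at most half of [q n * |y n|], so [|f (y n)|] exceeds [n / 2]; hence
   the factor [2]. *)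
have [n nM] : exists n, 2 * `|M| < n%:R.
  by exists (Num.bound (2 * `|M|)); apply: archi_boundP; rewrite mulr_ge0.
have [By yn] := yP n; have := fM _ By; apply/negP; rewrite -ltNge /=.
have Fn : q n * `|y n| <= `|F n.+1 (y n)|.
  rewrite /= (gP n).2 [s _ _ * _](_ : _ = if q n * `|y n| <=
    `|F n (y n) + q n * `|y n| | then q n * `|y n| else - (q n * `|y n|)).
    by apply: sign_choice; rewrite mulr_ge0// ltW.
  by rewrite /s; case: (_ <= _); rewrite ?mulNr.
have qy : n%:R < q n * `|y n|.
  by rewrite /q exprVn mulrC ltr_pdivlMr ?exprn_gt0.
have := ler_normD (f (y n)) (F n.+1 (y n) - f (y n)).
rewrite addrC subrK => /(le_trans Fn).
have := fP (y n) n.+1; rewrite distrC /e qS.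
have := ler_norm M; lra.
Qed.

(** For multipliers of modulus at most [1], a functional [f] maps all these sums below a bound for
    the partial sums of [|f (x i)|]. So they are weakly bounded, hence bounded, and homogeneity
    gives general [d]. *)
Lemma wuC_sum_bounded (X : normedModType R) (x : nat -> X) : wuC x ->
  exists2 C, 0 <= C & forall (b : nat -> R) d n, (forall i, `|b i| <= d) ->
    `|series (fun i => b i *: x i) n| <= C * d.
Proof.
move=> wx.
pose B := [set z | exists (b : nat -> R) n, (forall i, `|b i| <= 1) /\
  z = series (fun i => b i *: x i) n].
have [f fc|M BM] := @weakly_bounded X B.
  have [|M fM] := @rearrangements_cauchy_abs_bounded R (f \o x).
    move=> pi pi_bij; have := wx pi pi_bij f fc.
    suff -> : f \o series (x \o pi) = series ((f \o x) \o pi) by [].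
    by apply/funext => n; rewrite /series /= linear_sum.
  exists M => _ [b [n [b1 ->]]].
  rewrite /series /= linear_sum (le_trans (ler_norm_sum _ _ _))//.
  rewrite big_mkord (le_trans _ (fM n))// ler_sum// => i _.
  by rewrite linearZ /= normrM ler_piMl.
exists `|M| => // b d n bd.
have : 0 <= d by rewrite (le_trans _ (bd 0%N)).
rewrite le_eqVlt => /predU1P[d0|d0].
  rewrite /series /= big1 ?normr0 -?d0 ?mulr0// => i _.
  have := bd i; rewrite -d0 normr_le0 => /eqP ->; exact: scale0r.
have : B (d^-1 *: series (fun i => b i *: x i) n).
  exists (fun i => d^-1 * b i), n; split=> [i|].
    by rewrite normrM normfV (gtr0_norm d0) ler_pdivrMl// mulr1.
  by rewrite /series /= scaler_sumr; apply: eq_bigr => i _; rewrite scalerA.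
move=> /BM; rewrite normrZ normfV (gtr0_norm d0) ler_pdivrMl// mulrC =>
  /le_trans; apply.
by rewrite ler_wpM2r ?(ltW d0)// ler_norm.
Qed.

End uniform_boundedness.

(** * Averages over lacunary blocks *)

Section lacunary_averages.
Context {R : realType}.
Variable theta : nat -> nat.
Hypothesis theta_lac : lacunary theta.

Definition lac_avg (v : nat -> R) (r : nat) : R :=
  (lac_step theta r)%:R^-1 *
    \sum_((theta r.-1).+1 <= k < (theta r).+1) v k.

Lemma lac_ge r : (r <= theta r)%N.
Proof.
have [_ mono _] := theta_lac; elim: r => // r ih.
by rewrite (leq_ltn_trans ih)// mono.
Qed.

Lemma lac_avg_cst d r : (0 < r)%N -> lac_avg (fun=> d) r = d.
Proof.
have [_ mono _] := theta_lac; case: r => // r _.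
rewrite /lac_avg /lac_step /= sumr_const_nat subSS -[d *+ _]mulr_natl mulrA
  mulVf ?mul1r//.
by rewrite pnatr_eq0 -lt0n subn_gt0 mono.
Qed.

Lemma lac_avgD (v w : nat -> R) r :
  lac_avg (fun k => v k + w k) r = lac_avg v r + lac_avg w r.
Proof. by rewrite /lac_avg big_split /= mulrDr. Qed.

Lemma lac_avg_ge0 (v : nat -> R) r : (forall k, 0 <= v k) -> 0 <= lac_avg v r.
Proof. by move=> v0; rewrite mulr_ge0 ?invr_ge0// sumr_ge0. Qed.

(** Block [r] lies beyond [theta r.-1 >= r.-1], so late blocks contain only indices where the
    inequality holds. *)
Lemma lac_avg_le (v w : nat -> R) d :
    (\forall k \near \oo, v k <= w k + d) ->
  \forall r \near \oo, lac_avg v r <= lac_avg w r + d.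
Proof.
move=> [m _ vw]; exists m.+1 => //= -[//|r] /= mr.
rewrite -[in leRHS](@lac_avg_cst d r.+1)// -lac_avgD ler_wpM2l ?invr_ge0//.
rewrite !big_nat; apply: ler_sum => k /andP[rk _]; apply: vw => /=.
exact: leq_trans (leq_trans (mr : (m <= r)%N) (lac_ge r)) (ltnW rk).
Qed.

Section normed.
Context {X : normedModType R}.
Implicit Types (s t : nat -> X) (L M : X).

(** This serves both for ordinary convergence, with [t] constant, and for partial sums approximated
    uniformly by those of summable series. *)
Lemma Ntheta_cvg_approx s L :
    (forall e, 0 < e -> exists t M, Ntheta_cvg_to theta t M /\
      \forall k \near \oo, `|s k - L| <= `|t k - M| + e) ->
  Ntheta_cvg_to theta s L.
Proof.
move=> approx; apply/cvgrPdist_lt => e e0.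
have e2 : 0 < e / 2 by rewrite divr_gt0.
have [t [M [tM st]]] := approx _ e2.
move/cvgrPdist_lt : tM => /(_ _ e2) tM.
apply: filterS2 (lac_avg_le st) tM => r str.
rewrite sub0r normrN => /ltr_normlW tr.
rewrite sub0r normrN ger0_norm;
  last exact: (@lac_avg_ge0 (fun k => `|s k - L|)).
rewrite -/(lac_avg (fun k => `|s k - L|) r) (le_lt_trans str)//.
by rewrite -ltrBrDr (lt_le_trans tr)//; lra.
Qed.

Lemma cvg_Ntheta s L : s @ \oo --> L -> Ntheta_cvg_to theta s L.
Proof.
move=> sL; apply: Ntheta_cvg_approx => e e0; exists (fun=> L), L; split.
  rewrite /Ntheta_cvg_to (_ : (fun r => _) = fun=> 0); first exact: cvg_cst.
  by apply/funext => r; rewrite big1 ?mulr0// => i _; rewrite subrr normr0.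
move/cvgrPdist_lt : sL => /(_ _ e0); apply: filterS => k.
by rewrite subrr normr0 add0r distrC => /ltW.
Qed.

(** The constant [|L - M|] is at most [|s k - L| + |t k - M| + d]; averaging over a late block
    leaves [d] up to a small error. *)
Lemma Ntheta_limit_dist s t L M d :
    Ntheta_cvg_to theta s L -> Ntheta_cvg_to theta t M ->
    (\forall k \near \oo, `|s k - t k| <= d) ->
  `|L - M| <= d.
Proof.
move=> sL tM std; apply/ler_addgt0Pl => e e0.
have e2 : 0 < e / 2 by rewrite divr_gt0.
have LM : \forall k \near \oo, `|L - M| <= (`|s k - L| + `|t k - M|) + d.
  apply: filterS std => k std.
  rewrite (_ : L - M = (L - s k) + (t k - M) + (s k - t k)).
    rewrite (le_trans (ler_normD _ _))// lerD// (le_trans (ler_normD _ _))//.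
    by rewrite distrC.
  by rewrite [RHS]addrACA subrK [t k - M - _]addrAC subrr add0r.
have := lac_avg_le LM.
move/cvgrPdist_lt : sL => /(_ _ e2).
move/cvgrPdist_lt : tM => /(_ _ e2) tM sL LMr.
near \oo => r.
rewrite -(@lac_avg_cst `|L - M| r); last by near: r; exact: nbhs_infty_gt.
apply: (@le_trans _ _ (lac_avg (fun k => `|s k - L| + `|t k - M|) r + d)).
  by near: r.
rewrite lerD2r lac_avgD.
have : `|0 - lac_avg (fun k => `|s k - L|) r| < e / 2 by near: r.
have : `|0 - lac_avg (fun k => `|t k - M|) r| < e / 2 by near: r.
by rewrite !sub0r !normrN => /ltr_normlW + /ltr_normlW; lra.
Unshelve. all: by end_near. Qed.

End normed.
End lacunary_averages.

(** * From Cauchy filters to Cauchy sequences with a prescribed rate *)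

Section completeness.
Context {R : realType}.

Lemma cauchy_filter_seq (T : pseudoMetricType R) (F : set_system T)
    (e : nat -> R) :
    ProperFilter F -> cauchy F -> (forall n, 0 < e n) -> e @ \oo --> 0 ->
  exists u : nat -> T, (forall n m, (n <= m)%N -> ball (u n) (e n) (u m)) /\
    forall l : T, u @ \oo --> l -> F --> l.
Proof.
move=> FF /cauchyP Fc e0 ecvg.
have /choice[x xP] n : exists x, F (ball x (e n / 2)).
  by apply: Fc; rewrite divr_gt0.
(* Choosing [u n] in all balls up to index [n] keeps every later [u m] in the [n]-th ball, which
   gives the rate [e n]. *)
pose D n := \bigcap_(k in [set k | (k <= n)%N]) ball (x k) (e k / 2).
have FD n : F (D n).
  elim: n => [|n ih].
    by apply: filterS (xP 0%N) => y xy k /=; rewrite leqn0 => /eqP ->.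
  apply: filterS2 ih (xP n.+1) => y Dy xy k /=.
  by rewrite leq_eqVlt ltnS => /predU1P[->//|]; exact: Dy.
have /choice[u uD] n : exists y, D n y by exact: filter_ex (FD n).
exists u; split=> [n m nm|l ul].
  by apply: (@ball_splitr _ _ (x n)); apply: uD => /=.
apply/fcvg_ballP => d d0.
have d2 : 0 < d / 2 by rewrite divr_gt0.
near \oo => n.
have un : ball l (d / 2) (u n) by near: n; exact: cvg_ball ul _ d2.
have en : e n < d / 2.
  have : `|0 - e n| < d / 2 by near: n; move/cvgrPdist_lt : ecvg; exact.
  by rewrite sub0r normrN gtr0_norm.
apply: filterS (xP n) => y xy; apply: ball_split un _.
apply: (le_ball (ltW en)); apply: (@ball_splitr _ _ (x n)) => //.
by apply: uD => /=.
Unshelve. all: by end_near. Qed.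

Lemma complete_space_seq (X : normedModType R) (u : nat -> X) (e : nat -> R) :
    complete_space X -> e @ \oo --> 0 ->
    (forall n m, (n <= m)%N -> `|u n - u m| <= e n) ->
  exists L, forall n, `|u n - L| <= e n.
Proof.
move=> Xc ecvg ue.
have [|L uL] := Xc (u @ \oo) _.
  apply/cauchyP => d d0; near \oo => n; exists (u n); exists n => // m /= nm.
  rewrite -ball_normE /= (le_lt_trans (ue _ _ nm))//.
  have : `|0 - e n| < d by near: n; move/cvgrPdist_lt : ecvg; exact.
  by rewrite sub0r normrN => /ltr_normlW.
exists L => n; apply/ler_addgt0Pr => d d0.
near \oo => m.
rewrite -(subrK (u m) (u n)) -addrA (le_trans (ler_normD _ _))// lerD//.
  by apply: ue; near: m; exact: nbhs_infty_ge.
rewrite distrC ltW//; near: m; move/cvgrPdist_lt : uL; exact.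
Unshelve. all: by end_near. Qed.

Lemma complete_space_real : complete_space R.
Proof. by move=> F FF Fc; exists (lim F); exact: cauchy_cvg. Qed.

Lemma linfty_coord (a : linfty R) i : `|a i| <= `|a|.
Proof. exact: le_supnorm. Qed.

Lemma linfty_norm_le (a : linfty R) M : (forall i, `|a i| <= M) -> `|a| <= M.
Proof. exact: supnorm_le. Qed.

(** Limits are taken coordinatewise; the rate [e n] does not depend on the coordinate. *)
Lemma linfty_complete_seq (a : nat -> linfty R) (e : nat -> R) :
    e @ \oo --> 0 -> (forall n m, (n <= m)%N -> `|a n - a m| <= e n) ->
  exists b : linfty R, forall n, `|a n - b| <= e n.
Proof.
move=> ecvg ae.
have /choice[b bP] i : exists b, forall n, `|a n i - b| <= e n.
  apply: complete_space_seq complete_space_real ecvg _ => n m nm.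
  exact: le_trans (linfty_coord (a n - a m) i) (ae _ _ nm).
have b_bdd : b \in linfty_pred.
  apply/linftyP; exists (`|a 0%N| + e 0%N) => i.
  rewrite -[b i](subKr (a 0%N i)) (le_trans (ler_normB _ _))// lerD//.
  exact: linfty_coord.
by exists (Linfty b_bdd) => n; apply: linfty_norm_le => i; exact: bP.
Qed.

End completeness.

(** * A complete space has complete multiplier spaces *)

Section completeness_of_summing_multipliers.
Context {R : realType} {X : normedModType R}.
Variable theta : nat -> nat.
Hypothesis theta_lac : lacunary theta.

Lemma set_type_linftyP (S : set (linfty R)) (a b : set_type S) (d : R) :
  ball a d b <-> `|set_val a - set_val b| < d.
Proof.
change (ball (set_val a) d (set_val b) <-> `|set_val a - set_val b| < d).
by rewrite -ball_normE.
Qed.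

Lemma cvg_near_lt (e : nat -> R) (d : R) : e @ \oo --> 0 -> 0 < d ->
  \forall n \near \oo, e n < d.
Proof.
move=> /cvgrPdist_lt + d0 => /(_ _ d0); apply: filterS => n.
by rewrite sub0r normrN => /ltr_normlW.
Qed.

Lemma complete_S_Ntheta (x : nat -> X) : complete_space X -> wuC x ->
  complete_space (set_type (S_Ntheta theta x)).
Proof.
move=> Xc wx F FF Fc.
pose e : nat -> R := harmonic.
have ecvg : e @ \oo --> 0 by exact: cvg_harmonic.
have [u [uc uF]] := cauchy_filter_seq FF Fc (@harmonic_gt0 R) ecvg.
pose a n : linfty R := set_val (u n).
have ae n m : (n <= m)%N -> `|a n - a m| <= e n.
  by move=> nm; apply/ltW/set_type_linftyP; exact: uc.
have [b ab] := linfty_complete_seq ecvg ae.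
have [C C0 xC] := wuC_sum_bounded wx.
have dist_series (c d : linfty R) D k : `|c - d| <= D ->
    `|series (fun i => c i *: x i) k - series (fun i => d i *: x i) k| <= C * D.
  move=> cdD; rewrite /series /= -sumrB.
  rewrite (eq_bigr (fun i => (c - d : linfty R) i *: x i)) => [|i _];
    last by rewrite -scalerBl.
  by apply: xC => i; exact: le_trans (linfty_coord (c - d) i) cdD.
have /choice[L uL] n : Ntheta_summable theta (fun i => a n i *: x i).
  exact: set_valP (u n).
have Cecvg : (fun n => C * e n) @ \oo --> 0.
  by rewrite -[X in _ --> X](mulr0 C); exact: cvgMr.
have [|M LM] := complete_space_seq Xc Cecvg (u := L).
  move=> n m nm; apply: (Ntheta_limit_dist theta_lac (uL n) (uL m)).
  by near=> k; exact: dist_series (ae _ _ nm).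
have Sb : S_Ntheta theta x b.
  exists M; apply: (Ntheta_cvg_approx theta_lac) => d d0.
  (* One [d / 2] pays for replacing [b] by [a n] in the partial sums, uniformly in [k], the other
     for passing from [L n] to [M]. *)
  have [|n _ /(_ _ (leqnn n)) end_] :=
    @cvg_near_lt (fun n => C * e n) (d / 2) Cecvg.
    by rewrite divr_gt0.
  exists (series (fun i => a n i *: x i)), (L n); split=> //; near=> k.
  set s := series _ k; set s' := series _ k.
  have ss' : `|s - s'| <= C * e n by apply: dist_series; rewrite distrC.
  rewrite (_ : s - M = (s' - L n) + ((s - s') + (L n - M))).
    rewrite (le_trans (ler_normD _ _))// lerD// (le_trans (ler_normD _ _))//.
    have := LM n; move: ss' end_; lra.
  by rewrite [RHS]addrCA !subrKA.
exists (exist _ b (mem_set Sb)); apply: uF; apply/cvg_ballP => d d0.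
near=> n; apply/set_type_linftyP; rewrite distrC (le_lt_trans (ab n))//.
by near: n; exact: cvg_near_lt.
Unshelve. all: by end_near. Qed.

(** * The converse implication *)

Lemma continuous_scalar_bounded (f : {scalar X}) : continuous f ->
  exists2 K, 0 <= K & forall y, `|f y| <= K * `|y|.
Proof.
move=> /(_ 0) f0; pose g : {linear X -> R^o} := f.
have /(@linear_boundedP _ _ _ g) gb :=
  @continuous_linear_bounded _ X R^o 0 g f0.
near +oo_R => K; exists K => //; near: K; exact: gb.
Unshelve. all: by end_near. Qed.

(** The first [n] values of a permutation form such a list. Up to order it is part of [iota 0 B],
    whose sum is [2 - 2 * 2^-B]. *)
Lemma sum_half_le (s : seq nat) : uniq s -> \sum_(i <- s) (2^-1 : R) ^+ i <= 2.
Proof.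
move=> us; pose B := (\max_(i <- s) i).+1.
have half_ge0 i : 0 <= (2^-1 : R) ^+ i by rewrite exprn_ge0// invr_ge0.
have sB : perm_eq s [seq i <- iota 0 B | i \in s].
  apply: uniq_perm => //; first by rewrite filter_uniq// iota_uniq.
  move=> i; rewrite mem_filter mem_iota /= add0n ltnS.
  by case: (boolP (i \in s)) => //= si; rewrite leq_bigmax_seq.
rewrite (perm_big _ sB) big_filter big_mkcond /=.
apply: (@le_trans _ _ (\sum_(i <- iota 0 B) 2^-1 ^+ i)).
  by apply: ler_sum => i _; case: ifP.
suff -> : \sum_(i <- iota 0 B) (2^-1 : R) ^+ i = 2 - 2 * 2^-1 ^+ B.
  by rewrite gerBl mulr_ge0.
elim: {sB} B => [|B ih]; first by rewrite big_nil expr0 mulr1 subrr.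
rewrite -addn1 iotaD big_cat big_seq1 /= ih add0n addn1 exprS; lra.
Qed.

Lemma geometric_wuC (x : nat -> X) :
  (forall n, `|x n| <= 2^-1 ^+ n) -> wuC x.
Proof.
move=> x2 pi pi_bij f fc.
have [K K0 fK] := continuous_scalar_bounded fc.
have -> : f \o series (x \o pi) = series (f \o x \o pi).
  by apply/funext => n; rewrite /series /= linear_sum.
apply: cvg_cauchy; apply: normed_cvg.
apply: nondecreasing_is_cvgn.
  by apply: nondecreasing_series => k _ _; exact: normr_ge0.
exists (K * 2) => _ [n _ <-].
have : \sum_(i <- map pi (index_iota 0 n)) (2^-1 : R) ^+ i <= 2.
  by apply: sum_half_le; rewrite (map_inj_uniq (bij_inj pi_bij)) iota_uniq.
rewrite big_map => /(ler_wpM2l K0); apply: le_trans.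
rewrite mulr_sumr /series /=; apply: ler_sum => i _.
by rewrite (le_trans (fK _))// ler_wpM2l.
Qed.

(** From index [n] on, [s] stays within [e n] of the constant sequence [s n], so their limits do
    too. *)
Lemma Ntheta_cauchy_limit (s : nat -> X) (L : X) (e : nat -> R) :
    (forall n m, (n <= m)%N -> `|s n - s m| <= e n) ->
    Ntheta_cvg_to theta s L ->
  forall n, `|s n - L| <= e n.
Proof.
move=> se sL n.
apply: (Ntheta_limit_dist theta_lac (cvg_Ntheta theta_lac (cvg_cst (s n))) sL).
by exists n => // m; exact: se.
Qed.

Lemma complete_of_S_Ntheta :
    (forall x : nat -> X, wuC x ->
      complete_space (set_type (S_Ntheta theta x))) ->
  complete_space X.
Proof.
move=> Sc F FF Fc.
pose h : nat -> R := harmonic.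
have hcvg : h @ \oo --> 0 by exact: cvg_harmonic.
have hle n m : (n <= m)%N -> h m <= h n.
  by move=> nm; rewrite /h /= lef_pV2 ?posrE// ler_nat.
have half1 n : (2^-1 : R) ^+ n <= 1 by apply: exprn_ile1; lra.
(* The factor [h n = 1 / (n + 1)] absorbs the weight [n + 1] in [x n], leaving [|x n| <= 2^-n]. *)
pose e n : R := h n * 2^-1 ^+ n.
have e0 n : 0 < e n by rewrite mulr_gt0 ?exprn_gt0 ?invr_gt0// harmonic_gt0.
have eh n : e n <= h n by rewrite ler_piMr// ltW// harmonic_gt0.
have ecvg : e @ \oo --> 0.
  apply: (squeeze_cvgr _ (cvg_cst 0) hcvg).
  by near=> n; rewrite eh ltW.
have [u [uc uF]] := cauchy_filter_seq FF Fc e0 ecvg.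
have ue n m : (n <= m)%N -> `|u n - u m| <= e n.
  by move=> nm; have := uc n m nm; rewrite -ball_normE => /ltW.
pose x n := n.+1%:R *: (u n.+1 - u n).
have xwuC : wuC x.
  apply: geometric_wuC => n; rewrite normrZ normr_nat distrC.
  have := ue n n.+1 (leqnSn n); rewrite -(ler_pM2l (ltr0Sn R n)) => /le_trans;
    apply.
  by rewrite /e /h /= mulrA mulfV// mul1r.
have trunc_bdd n : (fun i => if (i < n)%N then h i else 0) \in linfty_pred.
  apply/linftyP; exists 1 => i; case: ifP => _; last by rewrite normr0.
  by rewrite gtr0_norm ?harmonic_gt0// (le_trans (hle 0%N i _))// /h /= invr1.
pose a n : linfty R := Linfty (trunc_bdd n).
have aS n : S_Ntheta theta x (a n).
  exists (series (fun i => a n i *: x i) n); apply: (cvg_Ntheta theta_lac).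
  (* The truncated series has constant partial sums from [n] on. *)
  apply: cvg_near_cst; exists n => // m /= nm.
  rewrite /series /= (@big_cat_nat _ _ _ n 0%N m)//= [X in _ + X]big1_seq
    ?addr0//.
  move=> i; rewrite mem_index_iota => /andP[_ /andP[ni _]].
  by rewrite ltnNge ni /= scale0r.
pose v n : set_type (S_Ntheta theta x) := exist _ (a n) (mem_set (aS n)).
have aa n m : (n <= m)%N -> `|a n - a m| <= h n.
  move=> nm; apply: linfty_norm_le => i.
  change (`|(if (i < n)%N then h i else 0) - (if (i < m)%N then h i else 0)|
    <= h n).
  have [im|mi] := ltnP i m; last first.
    by rewrite ltnNge (leq_trans nm mi) /= subrr normr0 ltW// harmonic_gt0.
  have [im'|ni] := ltnP i n; first by rewrite subrr normr0 ltW// harmonic_gt0.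
  by rewrite sub0r normrN gtr0_norm ?harmonic_gt0// hle.
have [|b vb] := Sc x xwuC (v @ \oo) _.
  apply/cauchyP => d d0; near \oo => n; exists (v n); exists n => // m /= nm.
  apply/set_type_linftyP; rewrite (le_lt_trans (aa _ _ nm))//.
  by near: n; exact: cvg_near_lt.
(* Coordinate [i] of [a n] is [h i] once [n > i], so the uniform limit can only be [h]. *)
have bh i : set_val b i = h i.
  apply/eqP; rewrite -subr_eq0 -normr_le0; apply/ler_addgt0Pl => d d0.
  rewrite addr0; near \oo => n.
  have /set_type_linftyP bn : ball b d (v n).
    by near: n; exact: cvg_ball vb _ d0.
  have hn : h i = a n i by rewrite /= ifT//; near: n; exact: nbhs_infty_gt.
  rewrite hn (le_trans _ (ltW bn))//; exact: linfty_coord (set_val b - a n) i.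
have [L bL] : S_Ntheta theta x (set_val b) by exact: set_valP.
have sE : series (fun i => set_val b i *: x i) = fun n => u n - u 0%N.
  apply/funext => n; rewrite /series /= -telescope_sumr//.
  apply: eq_bigr => i _; rewrite bh /h /x scalerA /= mulVf//.
  exact: scale1r.
have uL n : `|u n - u 0%N - L| <= e n.
  apply: (@Ntheta_cauchy_limit (fun n => u n - u 0%N)); last by rewrite -sE.
  by move=> k m km; rewrite opprB addrA subrK ue.
(* The telescoping sum started at [u 0], which is added back here. *)
exists (L + u 0%N); apply: uF; apply/cvgrPdist_lt => d d0.
near=> n; rewrite distrC opprD addrA addrAC (le_lt_trans (uL n))//.
by near: n; exact: cvg_near_lt.
Unshelve. all: by end_near. Qed.

End completeness_of_summing_multipliers.

Theorem theorem5p1 (R : realType) (X : normedModType R) (theta : nat -> nat)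
    (htheta : lacunary theta) :
  complete_space X <->
  (forall x : nat -> X, wuC x -> complete_space (set_type (S_Ntheta theta x))).
Proof.
split=> [Xc x wx|]; first exact: complete_S_Ntheta.
exact: complete_of_S_Ntheta.
Qed.
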